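(* Let $I\subseteq \mathbb{R}$ be an open interval and let $R:=C(I)$ be the $\mathbb{R}$-algebra of continuous functions on $I$. Let $\Omega$ be a nonempty set and let $K_\omega(x,t)=k_\omega(x)h_\omega(t)\in C(I^2)$, $\omega\in\Omega$ (with $k_\omega,h_\omega\in C(I)$), be a family of separable kernels such that every $k_\omega(x)$ is free of zeros on $I$. Let $a\in I$ and let $P_{K_\omega}(f)(x):=\int_a^xK_\omega(x,t)f(t)\,dt$, $\omega\in\Omega$, be the corresponding Volterra operators on $R$. Put $\tau_\omega:=\frac{k_\omega(x)}{k_\omega(a)}\in R$, $\omega\in\Omega$. Then $(R,(P_{K_\omega})_{\omega\in\Omega},(\tau_\omega)_{\omega\in\Omega})$ is an $\Omega$-matching twisted Rota-Baxter algebra (of weight $0$).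
   Context: An $\Omega$-matching twisted Rota-Baxter algebra (MTRBA) of weight $0$ with twist $\tau_\Omega=(\tau_\omega\mid\omega\in\Omega)$ is a commutative unital algebra $R$ over a field together with a family of linear operators $P_\omega:R\to R$, $\omega\in\Omega$, and a family of invertible elements $\tau_\omega\in R$, $\omega\in\Omega$, such that for all $x,y\in R$ and $\alpha,\beta\in\Omega$, $$P_\alpha(x)P_\beta(y)=\tau_\alpha P_\beta\left(\tau_\alpha^{-1}P_\alpha(x)y\right)+\tau_\beta P_\alpha\left(\tau_\beta^{-1}xP_\beta(y)\right).$$ *)

(* Defs.v *)
From HB Require Import structures.
From mathcomp Require Import all_boot all_order all_algebra.
From mathcomp Require Import all_classical all_reals all_analysis.

Set Implicit Arguments.
Unset Strict Implicit.
Unset Printing Implicit Defensive.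

Import Order.TTheory GRing.Theory Num.Theory.
Import numFieldNormedType.Exports.

Local Open Scope classical_set_scope.
Local Open Scope ring_scope.

(* Weight 0. *)
Record is_mtrba (F : fieldType) (A : comUnitAlgType F) (Omega : Type)
    (P : Omega -> A -> A) (tau : Omega -> A) : Prop := IsMTRBA {
  mtrba_linear : forall w, linear (P w) ;
  mtrba_unit : forall w, tau w \is a GRing.unit ;
  mtrba_eq : forall (x y : A) (alpha beta : Omega),
    P alpha x * P beta y =
      tau alpha * P beta ((tau alpha)^-1 * P alpha x * y)
      + tau beta * P alpha ((tau beta)^-1 * x * P beta y)
}.

Section continuous_functions.
Context {X : topologicalType} {R : realType}.
Notation C := (continuousType X R).

(* The pointwise ring and module structure is inherited from X -> R through the
   subtype of continuous functions. *)
Definition ctsp : {pred X -> R} := mem [set f : X -> R | continuous f].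
Definition ctsp_key : pred_key ctsp. Proof. exact. Qed.
Canonical ctsp_keyed := KeyedPred ctsp_key.

Definition cts_Sub (f : X -> R) (fP : f \in ctsp) : C := mkcts (set_mem fP).

Lemma cts_rect (K : C -> Type) :
  (forall f (fP : f \in ctsp), K (cts_Sub fP)) -> forall u, K u.
Proof.
move=> Ksub u.
have uP : (u : X -> R) \in ctsp by apply/mem_set => x; exact: cts_fun.
suff -> : u = cts_Sub uP by exact: Ksub.
exact/continuousEP.
Qed.

Lemma cts_SubK (f : X -> R) (fP : f \in ctsp) : cts_Sub fP = f :> (X -> R).
Proof. by []. Qed.

HB.instance Definition _ := isSub.Build _ _ C cts_rect cts_SubK.

Lemma cts_subring_closed : subring_closed ctsp.
Proof.
split=> [|f g|f g]; rewrite !inE/=.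
- by move=> x; exact: cvg_cst.
- by move=> cf cg x; apply: cvgB; [exact: cf|exact: cg].
- by move=> cf cg x; apply: cvgM; [exact: cf|exact: cg].
Qed.
HB.instance Definition _ := GRing.isSubringClosed.Build _ ctsp
  cts_subring_closed.

Lemma cts_scaler_closed : GRing.scaler_closed ctsp.
Proof.
move=> c f; rewrite !inE/= => cf x.
by apply: cvgM; [exact: cvg_cst|exact: cf].
Qed.
HB.instance Definition _ := GRing.isScaleClosed.Build _ _ ctsp
  cts_scaler_closed.

HB.instance Definition _ := GRing.SubChoice_isSubComPzRing.Build _ ctsp C
  cts_subring_closed.
HB.instance Definition _ := [SubZmodule_isSubLmodule of C by <:].

End continuous_functions.

Section continuous_functions_pointed.
Context {X : ptopologicalType} {R : realType}.
Notation C := (continuousType X R).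

Lemma cts_oner_neq0 : (1 : C) != 0.
Proof.
apply/eqP => /continuousEP/(_ point) /eqP.
by rewrite oner_eq0.
Qed.
HB.instance Definition _ := GRing.PzSemiRing_isNonZero.Build C cts_oner_neq0.

Lemma cts_scalerAl (c : R) (f g : C) : c *: (f * g) = c *: f * g.
Proof. by apply/continuousEP => x; exact: mulrA. Qed.
HB.instance Definition _ := GRing.Lmodule_isLalgebra.Build R C cts_scalerAl.
HB.instance Definition _ := GRing.Lalgebra_isComAlgebra.Build R C.

Lemma cts_inv_subproof (f : C) :
  (forall x, f x != 0) -> continuous (fun x => (f x)^-1).
Proof. by move=> f0 x; apply: cvgV => //; exact: cts_fun. Qed.

(* A continuous function is a unit iff it has no zeros; as required by the
   unit-ring interface, the inverse of a non-unit is itself. *)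
Definition cts_unit : pred C := fun f => `[< forall x, f x != 0 >].

Definition cts_inv (f : C) : C :=
  if pselect (forall x, f x != 0) is left f0 then mkcts (cts_inv_subproof f0)
  else f.

Lemma cts_mulVf : {in cts_unit, left_inverse 1 cts_inv *%R}.
Proof.
move=> f /asboolP f0; rewrite /cts_inv; case: pselect => // f0'.
by apply/continuousEP => x; exact: mulVf.
Qed.

Lemma cts_unitP (f g : C) : g * f = 1 -> cts_unit f.
Proof.
move=> gf; apply/asboolP => x; apply/eqP => fx0.
have /continuousEP/(_ x) := gf.
rewrite [LHS](_ : _ = g x * f x)// fx0 mulr0 => /esym/eqP.
by rewrite [X in X == _](_ : _ = 1)// oner_eq0.
Qed.

Lemma cts_inv_out : {in [predC cts_unit], cts_inv =1 id}.
Proof. by move=> f /asboolPn f0; rewrite /cts_inv; case: pselect. Qed.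

HB.instance Definition _ := GRing.ComNzRing_hasMulInverse.Build C
  cts_mulVf cts_unitP cts_inv_out.

End continuous_functions_pointed.

(* Nonempty, so that C(I) is a nontrivial ring; the interval may be unbounded on
   either side. *)
Record open_interval (R : realType) := OpenInterval {
  oi_set :> set R ;
  oi_open : open oi_set ;
  oi_is_interval : is_interval oi_set ;
  oi_nonempty : oi_set !=set0
}.

Section points.
Context {R : realType} (I : open_interval R).

(* The base point is an arbitrary one: it only serves to make the ring C(I)
   nontrivial and is unrelated to the base point of a Volterra operator. *)
Definition oi_pt := set_type I.
HB.instance Definition _ := Topological.on oi_pt.
HB.instance Definition _ := isPointed.Build oi_pt
  (SigSub (mem_set (projT2 (cid (oi_nonempty I))))).

End points.

Lemma continuous_pairf {X Y Z : topologicalType} (f : X -> Y) (g : X -> Z) x :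
  {for x, continuous f} -> {for x, continuous g} ->
  {for x, continuous (fun x => (f x, g x))}.
Proof. by move=> cf cg; exact: (cvg_pair cf cg). Qed.

Section oriented_integral.
Context {R : realType}.
Notation mu := (@lebesgue_measure R).

(* Usual sign convention: the integral from a to b is minus that from b to a. *)
Definition oriented_integral (a b : R) (g : R -> R) : R :=
  if a <= b then \int[mu]_(t in `[a, b]) g t
  else - \int[mu]_(t in `[b, a]) g t.

Lemma eq_oriented_integral (a b c d : R) (f g : R -> R) :
  c <= a <= d -> c <= b <= d -> {in `[c, d], f =1 g} ->
  oriented_integral a b f = oriented_integral a b g.
Proof.
move=> /andP[ca ad] /andP[cb bd] fg; rewrite /oriented_integral.
case: ifPn => [ab|_]; [|congr (- _)]; apply: eq_Rintegral => t;
  rewrite inE/= in_itv/= => /andP[at1 at2]; apply: fg;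
  by rewrite in_itv/= ?(le_trans ca at1) ?(le_trans cb at1)
    ?(le_trans at2 bd) ?(le_trans at2 ad).
Qed.

Lemma oriented_integralE (c d a b : R) (g : R -> R) :
  c <= a <= d -> c <= b <= d -> mu.-integrable `[c, d] (EFin \o g) ->
  oriented_integral a b g =
  \int[mu]_(t in `[c, b]) g t - \int[mu]_(t in `[c, a]) g t.
Proof.
have itvB x y : c <= x -> x <= y -> y <= d ->
    mu.-integrable `[c, d] (EFin \o g) ->
    \int[mu]_(t in `[x, y]) g t =
    \int[mu]_(t in `[c, y]) g t - \int[mu]_(t in `[c, x]) g t.
  move=> cx xy yd ig; rewrite Rintegral_itvB ?bnd_simp//; last first.
    by apply: integrableS ig => //; apply: subset_itvl; rewrite bnd_simp.
  rewrite Rintegral_itv_obnd_cbnd//; apply: integrableS ig => //.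
  by apply: subset_itv; rewrite bnd_simp.
move=> /andP[ca ad] /andP[cb bd] ig; rewrite /oriented_integral.
have [ab|/ltW ba] := leP a b; first exact: itvB.
by rewrite (itvB b a)// opprB.
Qed.

Lemma continuous_oriented_integral (G : R * R -> R) (a : R) :
  continuous G -> continuous (fun x => oriented_integral a x (fun t => G (x, t))).
Proof.
move=> cG x0.
pose c := Num.min a x0 - 1; pose d := Num.max a x0 + 1.
have ca : c < a by rewrite ltrBlDr gt_min ltrDl ltr01.
have cx0 : c < x0 by rewrite ltrBlDr gt_min (ltrDl x0) ltr01 orbT.
have ad : a < d.
  by rewrite (@le_lt_trans _ _ (Num.max a x0)) ?le_max ?lexx// ltrDl.
have x0d : x0 < d.
  by rewrite (@le_lt_trans _ _ (Num.max a x0)) ?le_max ?lexx ?orbT// ltrDl.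
have cd : c < d by exact: lt_trans ca ad.
have cGr x : continuous (fun t => G (x, t)).
  move=> t; apply: (@continuous_comp _ _ _ (fun t => (x, t)) G); last exact: cG.
  by apply: continuous_pairf; [exact: cvg_cst|exact: cvg_id].
have cGl t : continuous (fun x => G (x, t)).
  move=> x; apply: (@continuous_comp _ _ _ (fun x => (x, t)) G); last exact: cG.
  by apply: continuous_pairf; [exact: cvg_id|exact: cvg_cst].
have intG x u v : mu.-integrable `[u, v] (EFin \o (fun t => G (x, t))).
  apply: continuous_compact_integrable; first exact: segment_compact.
  exact/continuous_subspaceT/cGr.
have [M M0 GM] : exists2 M : R, 0 < M &
    forall x t, x \in `[c, d] -> t \in `[c, d] -> `|G (x, t)| <= M.
  have cptG : compact (G @` (`[c, d] `*` `[c, d])).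
    apply: continuous_compact; first exact: continuous_subspaceT.
    by apply: compact_setX; exact: segment_compact.
  have [N [_ NG]] := compact_bounded cptG.
  exists (`|N| + 1); first by rewrite ltr_wpDl.
  move=> x t xcd tcd; apply: NG; last by exists (x, t).
  by rewrite (le_lt_trans (ler_norm _))// ltrDl.
pose Psi (x y : R) := \int[mu]_(t in `[c, y]) G (x, t).
have cPsi y : y \in `[c, d] -> Psi x y @[x --> x0] --> Psi x0 y.
  move=> ycd.
  have iM : mu.-integrable `[c, y] (EFin \o cst M).
    apply: continuous_compact_integrable; first exact: segment_compact.
    by apply: continuous_subspaceT => ?; exact: cvg_cst.
  have cG_ae : {ae mu, forall t, `[c, y]%classic t ->
      {in `]c, d[%classic, continuous (fun x => G (x, t))}}.
    by apply: (aeW mu) => t _ x _; exact: cGl.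
  have bG_ae x : `]c, d[%classic x ->
      {ae mu, forall t, `[c, y]%classic t -> `|G (x, t)| <= cst M t}.
    move=> /= xcd; apply: (aeW mu) => t /= tcy; apply: GM.
      exact: subset_itv_oo_cc xcd.
    move: tcy ycd; rewrite !in_itv/= => /andP[-> ty] /andP[_ yd].
    exact: le_trans ty yd.
  have iG x : `]c, d[%classic x ->
      mu.-integrable `[c, y] (EFin \o (fun t => G (x, t))).
    by move=> _; exact: intG.
  apply: (@continuity_under_integral _ _ _ mu (fun x t => G (x, t)) `[c, y]
    (measurable_itv _) c d iG cG_ae (cst M) iM bG_ae).
  by rewrite inE/= in_itv/= cx0 x0d.
have PsiB x y z : x \in `[c, d] -> c <= y -> y <= z -> z <= d ->
    `|Psi x z - Psi x y| <= M * (z - y).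
  move=> xcd cy yz zd; rewrite /Psi Rintegral_itvB ?bnd_simp//.
  rewrite (Rintegral_itv_obnd_cbnd (b := BRight z)); last first.
    by apply: integrableS (intG x y z) => //; exact: subset_itv_oc_cc.
  apply: le_trans (le_normr_Rintegral _ _) _ => //.
  apply: (@le_trans _ _ (\int[mu]_(t in `[y, z]) M)).
    apply: le_Rintegral => //.
    - by apply: (@integrable_norm _ _ _ mu `[y, z]).
    - apply: continuous_compact_integrable; first exact: segment_compact.
      by apply: continuous_subspaceT => ?; exact: cvg_cst.
    - move=> t; rewrite /= in_itv/= => /andP[yt tz]; apply: GM => //.
      by rewrite in_itv/= (le_trans cy yt) (le_trans tz zd).
  rewrite Rintegral_cst//= lebesgue_measure_itv/= lte_fin.
  case: ifPn => // _; rewrite mulr0 mulr_ge0 ?(ltW M0)// subr_ge0//.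
have acd : c <= a <= d by rewrite !ltW.
have near_cd : \forall x \near x0, x \in `[c, d].
  near=> x; rewrite in_itv/=; apply/andP; split; apply/ltW.
    by near: x; exact: lt_nbhsr.
  by near: x; exact: lt_nbhsl.
rewrite /continuous_at.
have -> : oriented_integral a x0 (fun t => G (x0, t)) =
    (Psi x0 x0 - Psi x0 a) + 0.
  by rewrite addr0 (@oriented_integralE c d)// !ltW.
suff : (Psi x x0 - Psi x a) + (Psi x x - Psi x x0) @[x --> x0] -->
    (Psi x0 x0 - Psi x0 a) + 0.
  apply: cvg_trans; apply: near_eq_cvg; near=> x.
  have xcd : x \in `[c, d] by near: x.
  rewrite (@oriented_integralE c d)//.
  by rewrite -/(Psi x x) -/(Psi x a) addrC addrA subrK.
apply: cvgD.
  by apply: cvgB; apply: cPsi; rewrite in_itv/= !ltW.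
apply/cvgr0Pnorm_le => e e0; near=> x.
have xcd : x \in `[c, d] by near: x.
have xx0 : `|x0 - x| <= e / M.
  by near: x; apply: cvgr_dist_le; [exact: cvg_id|rewrite divr_gt0].
move: (xcd); rewrite in_itv/= => /andP[cx xd].
apply: (@le_trans _ _ (M * `|x0 - x|)); last by rewrite mulrC -ler_pdivlMr.
have [x0x|/ltW xx0'] := leP x0 x.
  by rewrite (distrC x0) (@ger0_norm _ (x - x0)) ?subr_ge0// PsiB// ltW.
by rewrite distrC (@ger0_norm _ (x0 - x)) ?subr_ge0// PsiB// ltW.
Unshelve. all: by end_near. Qed.

End oriented_integral.

Section volterra.
Context {R : realType} (I : open_interval R).
Notation CI := (continuousType (oi_pt I) R).
Notation CI2 := (continuousType (oi_pt I * oi_pt I)%type R).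

(* The integrand lives on I and is extended by 0 outside of I; the segment
   between a and x is contained in I, so that the extension plays no role. *)
Definition volterra_fun (a : oi_pt I) (K : CI2) (f : CI) (x : oi_pt I) : R :=
  oriented_integral (\val a) (\val x)
    ('valL_ 0 (fun t : oi_pt I => K (x, t) * f t)).

Lemma volterra_fun_continuous (a : oi_pt I) (K : CI2) (f : CI) :
  continuous (volterra_fun a K f).
Proof.
move=> x0.
have Ival (x : oi_pt I) : oi_set I (\val x) by case: x => x /= /set_mem.
have [e /= e0 eI] : \forall y \near (\val x0 : R), oi_set I y.
  by apply: open_nbhs_nbhs; split; [exact: oi_open|exact: Ival].
pose c := Num.min (\val a) (\val x0 - e / 2).
pose d := Num.max (\val a) (\val x0 + e / 2).
have e20 : 0 < e / 2 by rewrite divr_gt0.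
have e2e : e / 2 < e by rewrite ltr_pdivrMr// ltr_pMr// ltr1n.
have Ic : oi_set I c.
  rewrite /c minEle; case: ifP => _; first exact: Ival.
  by apply: eI; rewrite /ball/= opprB addrC subrK gtr0_norm.
have Id : oi_set I d.
  rewrite /d maxEle; case: ifP => _; last exact: Ival.
  by apply: eI; rewrite /ball/= opprD addrA subrr add0r normrN gtr0_norm.
have ca : c <= \val a by rewrite ge_min lexx.
have ad : \val a <= d by rewrite le_max lexx.
have cx0 : c < \val x0 by rewrite gt_min ltrBlDr ltrDl e20 orbT.
have x0d : \val x0 < d by rewrite lt_max ltrDl e20 orbT.
have cd : c <= d by exact: le_trans ca ad.
have rI t : oi_set I (Num.max c (Num.min t d)).
  apply: (oi_is_interval Ic Id).
  by rewrite le_max lexx/= ge_max cd/= ge_min lexx orbT.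
pose r (t : R) : oi_pt I := SigSub (mem_set (rI t)).
have cr : continuous r.
  apply: (@continuous_comp_initial _ _ _ (set_val : set_type I -> R)).
  have -> : (set_val \o r : R -> R) = (cst c) \max (id \min cst d).
    by apply/funext => t /=; rewrite set_valE.
  apply: max_fun_continuous; first by move=> ?; exact: cvg_cst.
  by apply: min_fun_continuous => ?; [exact: cvg_id|exact: cvg_cst].
have rK (x : oi_pt I) : c <= \val x <= d -> r (\val x) = x.
  move=> /andP[cx xd]; apply: val_inj => /=.
  by rewrite (min_idPl xd) (max_idPr cx).
pose G (p : R * R) : R := K (r p.1, r p.2) * f (r p.2).
have cG : continuous G.
  have cr1 : continuous (fun p : R * R => r p.1).
    by move=> p; apply: (@continuous_comp _ _ _ fst r); [exact: cvg_fst|exact: cr].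
  have cr2 : continuous (fun p : R * R => r p.2).
    by move=> p; apply: (@continuous_comp _ _ _ snd r); [exact: cvg_snd|exact: cr].
  move=> p; apply: cvgM.
    apply: (@continuous_comp _ _ _ (fun p : R * R => (r p.1, r p.2)) K).
      by apply: continuous_pairf; [exact: cr1|exact: cr2].
    exact: cts_fun.
  by apply: (@continuous_comp _ _ _ (fun p : R * R => r p.2) f);
    [exact: cr2|exact: cts_fun].
pose F (y : R) := oriented_integral (\val a) y (fun t => G (y, t)).
have cF : continuous F by exact: continuous_oriented_integral.
have cval : continuous (\val : oi_pt I -> R).
  exact: (@initial_continuous (set_type I) R set_val).
have FE (x : oi_pt I) : c <= \val x <= d -> volterra_fun a K f x = F (\val x).
  move=> xcd; apply: (@eq_oriented_integral _ _ _ c d) => //.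
    by rewrite ca ad.
  move=> t; rewrite in_itv/= => tcd.
  have It : oi_set I t by exact: (oi_is_interval Ic Id).
  pose t' : oi_pt I := SigSub (mem_set It).
  have -> : t = \val t' by [].
  rewrite /G /= (rK _ xcd) (rK t')//.
  exact: (congr1 (fun h => h (fun t : oi_pt I => K (x, t) * f t) t')
    (@sigL_valL _ _ 0 (I : set R))).
rewrite /continuous_at.
have -> : volterra_fun a K f x0 = F (\val x0) by rewrite FE// !ltW.
have : F (\val x) @[x --> x0] --> F (\val x0).
  by apply: (@continuous_comp _ _ _ (\val : oi_pt I -> R) F); [exact: cval|exact: cF].
have F0 : Filter (nbhs x0) by exact: nbhs_filter.
have nc : \forall x \near x0, c < \val x by exact: (cval x0 _ (lt_nbhsr cx0)).
have nd : \forall x \near x0, \val x < d by exact: (cval x0 _ (lt_nbhsl x0d)).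
have nF : \forall x \near x0, F (\val x) = volterra_fun a K f x.
  by apply: filterS2 nc nd => x cx xd; rewrite FE// !ltW.
by apply: cvg_trans; exact: (near_eq_cvg nF).
Qed.

Definition volterra (a : oi_pt I) (K : CI2) (f : CI) : CI :=
  mkcts (@volterra_fun_continuous a K f).

End volterra.

(* Main.v *)
From HB Require Import structures.
Require Import Defs.
From mathcomp Require Import all_boot all_order all_algebra.
From mathcomp Require Import all_classical all_reals all_analysis.

Set Implicit Arguments.
Unset Strict Implicit.
Unset Printing Implicit Defensive.

Import Order.TTheory GRing.Theory Num.Theory.
Import numFieldNormedType.Exports.

Local Open Scope classical_set_scope.
Local Open Scope ring_scope.

(** Write [J] for the primitive operator f |-> \int_a^x f on C(I), which is the
    Volterra operator with kernel [1]. For a separable kernel k(x) h(t) the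
    factor k(x) leaves the integral, so that the Volterra operator is
    f |-> k * J (h * f) ([volterra_separable]). Since [tau] is a constant
    multiple of [k], multiplying by [tau^-1] inside the integral removes the
    factor [k] of the inner operator, and multiplying by [tau] outside restores
    it. With u = h_alpha * x and v = h_beta * y, the twisted identity is
    therefore k_alpha * k_beta times

      J u * J v = J (J u * v + u * J v),

    which is integration by parts for two primitives vanishing at [a]
    ([volterra1M]); the algebraic part is [mtrba_of_rota_baxter].

    The analysis takes place on the whole line. A continuous function has a
    unique primitive vanishing at [a], namely its oriented integral
    ([oriented_integral_unique]), and this yields linearity and integration by
    parts by differentiating. Functions on the interval are reduced to this case
    by a retraction of the line onto the segment between [a] and the point of
    evaluation ([volterra_retract]). *)

(** A Rota-Baxter operator [J] of weight [0], with a multiplication before and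
    after it, satisfies the twisted identity: [tau] is a scalar multiple of [k],
    so that both terms on the right acquire the common factor
    [k alpha * k beta], and what is left is the Rota-Baxter identity of [J]. *)
Lemma mtrba_of_rota_baxter (F : fieldType) (A : comUnitAlgType F)
    (Omega : Type) (J : {linear A -> A}) (k h : Omega -> A) (c : Omega -> F)
    (P : Omega -> A -> A) (tau : Omega -> A) :
  (forall u v : A, J u * J v = J (J u * v + u * J v)) ->
  (forall w, linear (P w)) -> (forall w u, P w u = k w * J (h w * u)) ->
  (forall w, k w \is a GRing.unit) -> (forall w, c w != 0) ->
  (forall w, tau w = c w *: k w) ->
  is_mtrba P tau.
Proof.
move=> JM Plin PE kU c0 tauE.
have cU w : c w \is a GRing.unit by rewrite unitfE.
split=> // [w|x y alpha beta]; first by rewrite tauE scaler_unit.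
have twisted (al be : Omega) (u v : A) :
    tau al * P be ((tau al)^-1 * P al u * v) =
    k al * k be * J (J (h al * u) * (h be * v)).
  rewrite !PE.
  have -> : h be * ((tau al)^-1 * (k al * J (h al * u)) * v) =
      (c al)^-1 *: (J (h al * u) * (h be * v) : A).
    by rewrite tauE invrZ// -!scalerAl mulKr// -scalerAr mulrCA.
  rewrite linearZ tauE -scalerAr -!scalerAl -scalerAr scalerA mulfV//.
  by rewrite scale1r mulrA.
rewrite twisted [_^-1 * x * _]mulrAC twisted.
rewrite (mulrC (k beta)) -mulrDr -linearD [J (h beta * y) * _]mulrC.
by rewrite -JM !PE mulrACA.
Qed.

Section oriented_primitive.
Context {R : realType}.
Implicit Types (a x : R) (g G : R -> R).
Notation mu := (@lebesgue_measure R).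

Lemma oriented_integralxx a g : oriented_integral a a g = 0.
Proof. by rewrite /oriented_integral lexx set_itv1 Rintegral_set1. Qed.

(** Near [x], the oriented integral differs by a constant from the integral
    over [[c, s]] for a fixed [c] below both [a] and [x], so that no case
    analysis on the relative position of [a] and [x] is necessary. *)
Lemma is_derive_oriented_integral a x g : continuous g ->
  is_derive x 1 (fun s => oriented_integral a s g) (g x).
Proof.
move=> cg.
pose c := Num.min a x - 1; pose d := Num.max a x + 1.
have ca : c < a by rewrite ltrBlDr gt_min ltrDl ltr01.
have cx : c < x by rewrite ltrBlDr gt_min (ltrDl x) ltr01 orbT.
have ad : a < d.
  by rewrite (@le_lt_trans _ _ (Num.max a x)) ?le_max ?lexx// ltrDl.
have xd : x < d.
  by rewrite (@le_lt_trans _ _ (Num.max a x)) ?le_max ?lexx ?orbT// ltrDl.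
have ig : mu.-integrable `[c, d] (EFin \o g).
  apply: continuous_compact_integrable; first exact: segment_compact.
  exact: continuous_subspaceT.
have [dF F'x] := continuous_FTC1_closed xd ig cx (cg x).
set A := \int[mu]_(t in `[c, a]) g t.
have {F'x} dF : is_derive x 1 (fun s => \int[mu]_(t in `[c, s]) g t) (g x).
  by apply: DeriveDef; rewrite -?derive1E.
have := is_deriveB dF (is_derive_cst (\int[mu]_(t in `[c, a]) g t) x 1).
rewrite subr0; apply: near_eq_is_derive; near=> s.
rewrite (@oriented_integralE _ c d)//; first by rewrite !ltW.
apply/andP; split; apply/ltW.
  by near: s; exact: lt_nbhsr.
by near: s; exact: lt_nbhsl.
Unshelve. all: by end_near. Qed.

(** The fundamental theorem of calculus as a uniqueness principle: linearity and
    integration by parts follow by checking that a candidate vanishes at [a] and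
    has the expected derivative. *)
Lemma oriented_integral_unique a x g G : continuous g -> G a = 0 ->
  (forall s : R, is_derive s 1 G (g s)) -> G x = oriented_integral a x g.
Proof.
move=> cg Ga dG; apply/eqP; rewrite -subr_eq0; apply/eqP.
transitivity (G a - oriented_integral a a g); last first.
  by rewrite Ga oriented_integralxx subrr.
apply: (@is_derive_0_is_cst _ (fun s => G s - oriented_integral a s g)) => s.
have := is_deriveB (dG s) (is_derive_oriented_integral a s cg).
by rewrite subrr.
Qed.

Lemma oriented_integralZ a x c g : continuous g ->
  oriented_integral a x (fun t => c * g t) = c * oriented_integral a x g.
Proof.
move=> cg; apply/esym.
apply: (@oriented_integral_unique _ _ _ (fun s => c * oriented_integral a s g)).
- by move=> t; apply: cvgM; [exact: cvg_cst|exact: cg].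
- by rewrite oriented_integralxx mulr0.
by move=> s; apply: (@is_deriveZ _ _ _ _ c); exact: is_derive_oriented_integral.
Qed.

Lemma oriented_integralD a x (f g : R -> R) : continuous f -> continuous g ->
  oriented_integral a x (fun t => f t + g t) =
  oriented_integral a x f + oriented_integral a x g.
Proof.
move=> cf cg; apply/esym.
apply: (@oriented_integral_unique _ _ _
  (fun s => oriented_integral a s f + oriented_integral a s g)).
- by move=> t; apply: cvgD; [exact: cf|exact: cg].
- by rewrite !oriented_integralxx addr0.
by move=> s; apply: is_deriveD; exact: is_derive_oriented_integral.
Qed.

(** Integration by parts for two primitives that vanish at [a]: by the product
    rule, both sides have the same derivative in [x]. *)
Lemma oriented_integralM a x (f g : R -> R) :
  continuous f -> continuous g ->
  oriented_integral a x f * oriented_integral a x g =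
  oriented_integral a x (fun t =>
    oriented_integral a t f * g t + f t * oriented_integral a t g).
Proof.
move=> cf cg.
have df s := is_derive_oriented_integral a s cf.
have dg s := is_derive_oriented_integral a s cg.
have cont_int (u : R -> R) : continuous u ->
    continuous (fun s => oriented_integral a s u).
  move=> cu s; apply: differentiable_continuous; apply/derivable1_diffP.
  by have [] := is_derive_oriented_integral a s cu.
apply: (@oriented_integral_unique _ _ _
  (fun s => oriented_integral a s f * oriented_integral a s g)).
- move=> t; apply: cvgD; apply: cvgM; by
    [exact: cf|exact: cg|exact: (cont_int f cf)|exact: (cont_int g cg)].
- by rewrite oriented_integralxx mul0r.
move=> s; have := is_deriveM (df s) (dg s).
by rewrite /GRing.scale/= (mulrC (oriented_integral a s g)).
Qed.

End oriented_primitive.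

Section volterra_theory.
Context {R : realType} (I : open_interval R).
Notation CI := (continuousType (oi_pt I) R).
Notation CI2 := (continuousType (oi_pt I * oi_pt I)%type R).
Implicit Types (a x : oi_pt I) (f g : CI) (K : CI2).

(** Functions on [I] are replaced by continuous functions on the whole line by
    precomposing with the retraction [r] of the line onto the segment between
    [a] and [x]; this does not change the integrals along that segment. *)
Lemma volterra_retract a x : exists r : R -> oi_pt I,
  [/\ continuous r, r (\val x) = x &
   forall K f s, Num.min (\val a) (\val x) <= s <= Num.max (\val a) (\val x) ->
     volterra a K f (r s) =
     oriented_integral (\val a) s (fun t => K (r s, r t) * f (r t))].
Proof.
set c := Num.min _ _; set d := Num.max _ _.
have Ival (y : oi_pt I) : oi_set I (\val y) by case: y => y /= /set_mem.
have Ic : oi_set I c by rewrite /c minEle; case: ifP.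
have Id : oi_set I d by rewrite /d maxEle; case: ifP.
have ca : c <= \val a <= d by rewrite ge_min le_max !lexx.
have cx : c <= \val x <= d by rewrite ge_min le_max !lexx !orbT.
have cd : c <= d by case/andP: ca; exact: le_trans.
have rI t : oi_set I (Num.max c (Num.min t d)).
  apply: (oi_is_interval Ic Id).
  by rewrite le_max lexx/= ge_max cd/= ge_min lexx orbT.
pose r (t : R) : oi_pt I := SigSub (mem_set (rI t)).
have rK t : c <= t <= d -> \val (r t) = t.
  by move=> /andP[ct td] /=; rewrite (min_idPl td) (max_idPr ct).
exists r; split.
- apply: (@continuous_comp_initial _ _ _ (set_val : set_type I -> R)).
  have -> : (set_val \o r : R -> R) = (cst c) \max (id \min cst d).
    by apply/funext => t /=; rewrite set_valE.
  apply: max_fun_continuous; first by move=> ?; exact: cvg_cst.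
  by apply: min_fun_continuous => ?; [exact: cvg_id|exact: cvg_cst].
- by apply: val_inj; exact: rK.
move=> K f s csd; rewrite [LHS](_ : _ = volterra_fun a K f (r s))//.
rewrite /volterra_fun rK//.
apply: (@eq_oriented_integral _ _ _ c d) => // t; rewrite in_itv/= => tcd.
rewrite -{1}(rK _ tcd).
exact: (congr1 (fun h => h (fun y : oi_pt I => K (r s, y) * f y) (r t))
  (@sigL_valL _ _ 0 (I : set R))).
Qed.

Lemma continuous_comp_cts (r : R -> oi_pt I) f :
  continuous r -> continuous (fun t => f (r t)).
Proof.
by move=> cr t; apply: continuous_comp; [exact: cr|exact: cts_fun].
Qed.

Lemma continuous_comp_kernel (r : R -> oi_pt I) K x :
  continuous r -> continuous (fun t => K (x, r t)).
Proof.
move=> cr t; apply: (@continuous_comp _ _ _ (fun t => (x, r t)) K).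
  by apply: continuous_pairf; [exact: cvg_cst|exact: cr].
exact: cts_fun.
Qed.

Lemma mem_hull_l a x :
  Num.min (\val a) (\val x) <= \val a <= Num.max (\val a) (\val x).
Proof. by rewrite ge_min le_max !lexx. Qed.

Lemma mem_hull_r a x :
  Num.min (\val a) (\val x) <= \val x <= Num.max (\val a) (\val x).
Proof. by rewrite ge_min le_max !lexx !orbT. Qed.

Lemma volterra_linear a K : linear (volterra a K).
Proof.
move=> c f g; apply/continuousEP => x.
have [r [cr rx rE]] := volterra_retract a x.
rewrite [RHS](_ : _ = c * volterra a K f x + volterra a K g x)//.
rewrite -rx !rE ?mem_hull_r//.
have cKf (u : CI) : continuous (fun t => K (r (\val x), r t) * u (r t)).
  move=> t; apply: cvgM; first exact: continuous_comp_kernel.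
  exact: continuous_comp_cts.
rewrite -oriented_integralZ// -oriented_integralD//; last first.
  by move=> t; apply: cvgM; [exact: cvg_cst|exact: cKf].
by congr oriented_integral; apply/funext => t; rewrite mulrCA -mulrDr.
Qed.

HB.instance Definition _ a K :=
  GRing.isLinear.Build R CI CI *:%R (volterra a K) (@volterra_linear a K).

(* The kernel [1] gives the operator f |-> \int_a^x f. *)
Local Notation J a := (volterra a (1 : CI2)).

(** The factor [k x] does not depend on the integration variable. *)
Lemma volterra_separable a K (k h : CI) f :
  (forall x t, K (x, t) = k x * h t) -> volterra a K f = k * J a (h * f).
Proof.
move=> Kkh; apply/continuousEP => x.
have [r [cr rx rE]] := volterra_retract a x.
rewrite [RHS](_ : _ = k x * J a (h * f) x)// -rx !rE ?mem_hull_r//.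
rewrite -oriented_integralZ; last first.
  move=> t; apply: cvgM; first exact: continuous_comp_kernel.
  exact: continuous_comp_cts.
by congr oriented_integral; apply/funext => t; rewrite Kkh -mulrA mul1r.
Qed.

(** The primitive operator is a Rota-Baxter operator of weight [0]: this is
    integration by parts, evaluated at each point [x]. *)
Lemma volterra1M a f g : J a f * J a g = J a (J a f * g + f * J a g).
Proof.
apply/continuousEP => x.
have [r [cr rx rE]] := volterra_retract a x.
have J1E (u : CI) s :
    Num.min (\val a) (\val x) <= s <= Num.max (\val a) (\val x) ->
    J a u (r s) = oriented_integral (\val a) s (fun t => u (r t)).
  by move=> /rE ->; congr oriented_integral; apply/funext => t; exact: mul1r.
rewrite [LHS](_ : _ = J a f x * J a g x)// -rx !J1E ?mem_hull_r//.
rewrite oriented_integralM; [|exact: continuous_comp_cts..].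
apply: (eq_oriented_integral (mem_hull_l a x) (mem_hull_r a x)) => t.
by rewrite in_itv/= => tax; rewrite -!J1E.
Qed.

End volterra_theory.

Theorem theorem2p9 (R : realType) (I : open_interval R)
    (Omega : Type) (Omega_nonempty : inhabited Omega)
    (k h : Omega -> continuousType (oi_pt I) R)
    (K : Omega -> continuousType (oi_pt I * oi_pt I)%type R)
    (K_separable : forall w (x t : oi_pt I), K w (x, t) = k w x * h w t)
    (k_neq0 : forall w (x : oi_pt I), k w x != 0)
    (a : oi_pt I) :
  is_mtrba (F := R) (A := continuousType (oi_pt I) R)
    (fun w => volterra a (K w))
    (fun w => (k w a)^-1 *: k w).
Proof.
pose J : {linear continuousType (oi_pt I) R -> continuousType (oi_pt I) R} :=
  volterra a (1 : continuousType (oi_pt I * oi_pt I)%type R).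
apply: (@mtrba_of_rota_baxter _ _ _ J k h (fun w => (k w a)^-1)).
- exact: volterra1M.
- by move=> w; exact: volterra_linear.
- by move=> w u; exact: volterra_separable.
- by move=> w; apply/asboolP; exact: k_neq0.
- by move=> w; rewrite invr_eq0.
- by [].
Qed.
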